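(* Let $A$ be a real invertible expansive $d\times d$ matrix, $B\subset\mathbb{R}^d$ a finite set, and $p=\{p_b\}_{b\in B}$ weights with $p_b>0$ and $\sum_{b\in B}p_b=1$. Let $\mu$ be the Hutchinson measure, i.e. the unique Borel probability measure on $\mathbb{R}^d$ with $$\mu=\sum_{b\in B}p_b\,\mu\circ\tau_b^{-1},\qquad \tau_b(x)=A^{-1}(x+b).$$ If $\mu=\mu_{ac}+\mu_{cs}$, then either $\mu_{ac}=0$ or $\mu_{cs}=0$.
   Context: A matrix is expansive if all its eigenvalues are larger than $1$ in absolute value. For a Borel measure $\mu$ on $\mathbb{R}^d$, the canonical decomposition is $\mu=\mu_{ac}+\mu_{pp}+\mu_{cs}$ where $\mu_{ac}$ is the part absolutely continuous with respect to Lebesgue measure on $\mathbb{R}^d$, $\mu_{pp}$ is the atomic part, and $\mu_{cs}$ is the continuous (atomless) part singular with respect to Lebesgue measure. The hypothesis $\mu=\mu_{ac}+\mu_{cs}$ says that $\mu_{pp}=0$. *)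

(* Defs.v *)
From mathcomp Require Import all_boot all_order all_algebra.
From mathcomp Require Import finmap.
From mathcomp Require Import complex.
From mathcomp Require Import all_classical all_reals all_analysis.
Import numFieldNormedType.Exports.

Set Implicit Arguments.
Unset Strict Implicit.
Unset Printing Implicit Defensive.

Import Order.TTheory GRing.Theory Num.Theory.

Local Open Scope classical_set_scope.
Local Open Scope ring_scope.

(* R^d as column vectors, with its Borel sigma-algebra. *)
Definition Rd (R : realType) (d : nat) :=
  g_sigma_algebraType (@open 'cV[R]_d).

(* Eigenvalues range over R[i]: a real matrix may have non-real ones. *)
Definition expansive (R : realType) (d : nat) (A : 'M[R]_d) : Prop :=
  forall z : R[i], eigenvalue (map_mx (real_complex R) A) z -> 1 < `|z|.

Section lebesgue.
Context (R : realType) (d : nat).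

Definition box (a b : 'cV[R]_d) : set 'cV[R]_d :=
  [set x | forall i, x i 0 \in `]a i 0, b i 0]].

Definition box_volume (a b : 'cV[R]_d) : R := \prod_(i < d) (b i 0 - a i 0).

(* The infimum of the total volumes of the countable covers by boxes: this is
   the d-dimensional Lebesgue outer measure, and its restriction to the Borel
   sets is Lebesgue measure. Covers are indexed by subsets of nat, so that
   finite covers and the empty one are allowed (in R^0 the only box is the
   whole space, of volume 1). *)
Definition lebesgueRd (E : set (Rd R d)) : \bar R :=
  ereal_inf [set v | exists (K : set nat) (a b : nat -> 'cV[R]_d),
    [/\ forall k, K k -> forall i, a k i 0 <= b k i 0,
        E `<=` \bigcup_(k in K) box (a k) (b k) &
        v = \esum_(k in K) (box_volume (a k) (b k))%:E]].

Definition atomic (m : set (Rd R d) -> \bar R) : Prop :=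
  exists2 C : set (Rd R d), countable C & m (~` C) = 0%E.

Definition atomless (m : set (Rd R d) -> \bar R) : Prop :=
  forall x : Rd R d, m [set x] = 0%E.

Definition singular (m : set (Rd R d) -> \bar R) : Prop :=
  exists N : set (Rd R d),
    [/\ measurable N, lebesgueRd N = 0%E & m (~` N) = 0%E].

Definition canonical_decomposition
    (m m_ac m_pp m_cs : set (Rd R d) -> \bar R) : Prop :=
  [/\ forall E, measurable E -> m E = (m_ac E + m_pp E + m_cs E)%E,
      m_ac `<< lebesgueRd,
      atomic m_pp,
      atomless m_cs & singular m_cs].

End lebesgue.

Section hutchinson.
Context (R : realType) (d : nat).

Definition tau (A : 'M[R]_d) (b : 'cV[R]_d) (x : Rd R d) : Rd R d :=
  invmx A *m ((x : 'cV[R]_d) + b).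

Definition hutchinson_measure (A : 'M[R]_d) (B : {fset 'cV[R]_d})
    (p : 'cV[R]_d -> R) (mu : set (Rd R d) -> \bar R) : Prop :=
  forall E, measurable E ->
    mu E = (\sum_(b <- B) (p b)%:E * pushforward mu (tau A b) E)%E.

End hutchinson.

(* Main.v *)
Require Import Defs.
From mathcomp Require Import all_boot all_order all_algebra.
From mathcomp Require Import finmap.
From mathcomp Require Import complex.
From mathcomp Require Import ring lra.
From mathcomp Require Import all_classical all_reals all_analysis.
Set Implicit Arguments.
Unset Strict Implicit.
Unset Printing Implicit Defensive.
Import numFieldNormedType.Exports.
Import Order.TTheory GRing.Theory Num.Theory.
Local Open Scope classical_set_scope.
Local Open Scope ring_scope.

(* Let [T m] be the weighted sum of the images of [m] under the maps [tau A b].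
   Invertible affine maps preserve Lebesgue null sets, so [T] preserves both
   absolute continuity and singularity; hence the absolutely continuous part of
   the [T]-invariant [mu] is itself [T]-invariant. Since [A] is expansive, the
   powers of its inverse tend to [0], so long compositions of the [tau A b]
   contract any ball carrying most of the mass, and any two finite
   [T]-invariant measures are proportional. Thus [mu_ac] is a multiple
   [c * mu]; evaluated at a null set [N] carrying [mu_cs] this gives
   [c * mu N = 0]. If [c = 0] then [mu_ac = 0], and if [mu N = 0] then
   [mu_cs = 0]. *)

(** * Geometric decay of the powers of the inverse of an expansive matrix *)

Lemma map_mxX (R S : pzRingType) (f : {rmorphism R -> S}) (d : nat)
  (M : 'M[R]_d) (n : nat) : map_mx f (M ^+ n) = map_mx f M ^+ n.
Proof.
elim: n => [|n IHn]; first by rewrite !expr0 map_mx1.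
by rewrite !exprS map_mxM IHn.
Qed.

Lemma eigenvalue_invmx (F : fieldType) (n : nat) (B : 'M[F]_n) (l : F) :
  B \in unitmx -> eigenvalue (invmx B) l -> l != 0 /\ eigenvalue B l^-1.
Proof.
move=> uB /eigenvalueP[v vl v0].
have vE : v = l *: (v *m B) by rewrite scalemxAl -vl mulmxKV.
have l0 : l != 0 by apply: contraNneq v0 => l0; rewrite vE l0 scale0r.
split=> //; apply/eigenvalueP; exists v => //.
by rewrite [in RHS]vE scalerA mulVf// scale1r.
Qed.

(** The rate [s] lies strictly above both [q] and [r], and still below 1, which avoids the
    polynomial factor that appears when [q = r]. The constant [K'] is chosen so that
    [q * K' + |K| <= s * K'], which closes the induction. *)
Lemma geometric_recursion_bound (R : realFieldType) (x y : nat -> R)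
    (q r K : R) : 0 <= q < 1 -> 0 <= r < 1 -> (forall n, 0 <= x n) ->
    (forall n, y n <= K * r ^+ n) -> (forall n, x n.+1 <= q * x n + y n) ->
  let s := 1 - (1 - q) * (1 - r) / 2 in
  forall n, x n <= (x 0 + `|K| / (s - q)) * s ^+ n.
Proof.
move=> /andP[q0 q1] /andP[r0 r1] x0 yK xq s.
have qs : 0 < s - q by rewrite /s; nra.
have rs : r <= s by rewrite /s; nra.
have s0 : 0 <= s by lra.
set K' := x 0 + _.
have KK' : `|K| <= K' * (s - q).
  by rewrite /K' mulrDl divfK ?gt_eqF// lerDr mulr_ge0// ltW.
elim=> [|n IHn]; first by rewrite expr0 mulr1 lerDl divr_ge0// ltW.
apply: (le_trans (xq n)).
have yn : y n <= `|K| * s ^+ n.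
  apply: (le_trans (yK n)); apply: (le_trans (ler_norm _)).
  rewrite normrM normrX (ger0_norm r0) ler_wpM2l// lerXn2r//.
have sn : 0 <= s ^+ n by rewrite exprn_ge0.
rewrite exprS.
have := ler_wpM2l q0 IHn; have := ler_wpM2r sn KK'; nra.
Qed.

Section complex_modulus.
Variable R : rcfType.
Implicit Types x y : R[i].
Local Open Scope complex_scope.

(** The norm of [R[i]] takes its values in [R[i]]; this version is [R]-valued, as real estimates
    require. *)
Definition modulus x : R := complex.Re `|x|.

Lemma modulusE x : `|x| = (modulus x)%:C.
Proof. by case: x. Qed.

Lemma modulus_ge0 x : 0 <= modulus x.
Proof. by have := normr_ge0 x; rewrite modulusE lecR. Qed.

Lemma modulusM x y : modulus (x * y) = modulus x * modulus y.
Proof. by apply: (@complexI R); rewrite -modulusE rmorphM /= -!modulusE normrM. Qed.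

Lemma ler_modulusD x y : modulus (x + y) <= modulus x + modulus y.
Proof. by rewrite -lecR rmorphD /= -!modulusE ler_normD. Qed.

Lemma modulus_real (a : R) : modulus a%:C = `|a|.
Proof. by rewrite /modulus normc_def /= expr0n /= addr0 sqrtr_sqr. Qed.

End complex_modulus.

Section spectral_decay.
Variable R : realType.

(** The right factor [X] makes it possible to remove the linear factors of the characteristic
    polynomial one at a time. *)
Definition decays_on (d : nat) (M X : 'M[R[i]]_d) := exists K r : R,
  0 <= r < 1 /\ forall n i j, modulus ((M ^+ n *m X) i j) <= K * r ^+ n.

(** Since [M ^+ n.+1 *m X = l *: (M ^+ n *m X) + M ^+ n *m ((M - l%:M) *m X)], the modulus of each
    entry obeys the scalar recursion with [q] the modulus of [l]. *)
Lemma decays_on_factor (d : nat) (M X : 'M[R[i]]_d) (l : R[i]) : `|l| < 1 ->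
  decays_on M ((M - l%:M) *m X) -> decays_on M X.
Proof.
move=> l1 [K [r [r01 MK]]].
have q01 : 0 <= modulus l < 1 by rewrite modulus_ge0 -ltcR -modulusE.
pose q := modulus l; pose s := 1 - (1 - q) * (1 - r) / 2.
pose x i j n := modulus ((M ^+ n *m X) i j).
(* The bound depends on the entry; summing over all entries makes it uniform. *)
exists (\sum_i \sum_j (x i j 0 + `|K| / (s - q))), s.
have s0 : 0 <= s by rewrite /s /q; nra.
split; first by rewrite s0 /s /q; nra.
move=> n i j.
have term_ge0 i' j' : 0 <= x i' j' 0 + `|K| / (s - q).
  rewrite addr_ge0 ?modulus_ge0// divr_ge0//.
  by rewrite /s /q; nra.
apply: (@le_trans _ _ ((x i j 0 + `|K| / (s - q)) * s ^+ n)); last first.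
  rewrite ler_wpM2r ?exprn_ge0// (bigD1 i)//= (bigD1 j)//= -!addrA !lerD2l.
  rewrite addrA lerDl addr_ge0// ?sumr_ge0// => k _; rewrite ?sumr_ge0//.
apply: (@geometric_recursion_bound _ (x i j)
  (fun n => modulus ((M ^+ n *m ((M - l%:M) *m X)) i j)) q r K q01 r01) => [k|k|k].
- exact: modulus_ge0.
- exact: MK.
rewrite /x -modulusM; apply: le_trans (ler_modulusD _ _).
have -> : M ^+ k.+1 *m X = l *: (M ^+ k *m X) + M ^+ k *m ((M - l%:M) *m X).
  rewrite mulmxBl mulmxBr mul_scalar_mx -scalemxAr addrC subrK exprSr.
  by rewrite mulmxA.
by rewrite !mxE.
Qed.

Lemma decays_on_prod (d : nat) (M X : 'M[R[i]]_d) (s : seq R[i]) :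
  (forall l, l \in s -> `|l| < 1) ->
  decays_on M ((\prod_(l <- s) (M - l%:M)) *m X) -> decays_on M X.
Proof.
elim: s => [_|l s IHs ls1]; first by rewrite big_nil mul1mx.
rewrite big_cons -mulmxA => dec; apply: IHs => [k ks|].
  by apply: ls1; rewrite inE ks orbT.
by apply: decays_on_factor dec; apply: ls1; rewrite mem_head.
Qed.

(** By Cayley-Hamilton the product of the [M - l%:M] over the roots of the characteristic polynomial
    is 0, which decays trivially; no Jordan form is involved. *)
Lemma decays_on1 (d : nat) (M : 'M[R[i]]_d) :
  (forall l, eigenvalue M l -> `|l| < 1) -> decays_on M 1%:M.
Proof.
case: d M => [|d] M Ml1.
  by exists 0, 0; rewrite lexx ltr01; split => // n [].
have [s Es] := closed_field_poly_normal (char_poly M).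
rewrite (monicP (char_poly_monic M)) scale1r in Es.
apply: (@decays_on_prod _ _ _ s) => [l ls|].
  by apply: Ml1; rewrite eigenvalue_root_char Es root_prod_XsubC.
have <- : horner_mx M (char_poly M) = \prod_(l <- s) (M - l%:M).
  rewrite Es rmorph_prod /=; apply: eq_bigr => l _.
  by rewrite rmorphB /= horner_mx_X horner_mx_C.
rewrite Cayley_Hamilton mul0mx; exists 0, 0; rewrite lexx ltr01.
by split => // n i j; rewrite mulmx0 mxE modulus_real normr0 mul0r.
Qed.

Lemma expansive_invmx_decay (d : nat) (A : 'M[R]_d) :
    A \in unitmx -> expansive A ->
  exists K r : R, 0 <= r < 1 /\
    forall n i j, `|(invmx A ^+ n) i j| <= K * r ^+ n.
Proof.
move=> uA eA.
have [l|K [r [r01 MK]]] := @decays_on1 _ (map_mx (real_complex R) (invmx A)).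
  rewrite map_invmx => /eigenvalue_invmx[|l0]; first by rewrite map_unitmx.
  by move=> /eA; rewrite normfV invf_gt1 ?normr_gt0.
exists K, r; split => // n i j.
have := MK n i j; rewrite mulmx1 -modulus_real.
by rewrite -map_mxX mxE.
Qed.

End spectral_decay.

(** * Sup norm estimates, continuity of affine maps, and contraction by powers of the inverse *)

Section column_norm.
Variables (R : realType) (d : nat).
Implicit Types (M : 'M[R]_d) (z v : 'cV[R]_d).

Lemma ler_cV_norm z i : `|z i 0| <= `|z|.
Proof.
rewrite [leRHS]/Num.norm /= mx_normrE.
exact: (le_bigmax _ (fun ij => `|z ij.1 ij.2|) (i, 0)).
Qed.

Lemma cV_norm_le z (c : R) : 0 <= c -> (forall i, `|z i 0| <= c) -> `|z| <= c.
Proof.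
move=> c0 zc; rewrite [leLHS]/Num.norm /= mx_normrE.
by apply: bigmax_le => // -[i j] _ /=; rewrite ord1.
Qed.

Lemma ler_norm_mulmx M z : `|M *m z| <= (\sum_i \sum_j `|M i j|) * `|z|.
Proof.
have S0 i : 0 <= \sum_j `|M i j| by apply: sumr_ge0.
apply: cV_norm_le => [|i]; first by rewrite mulr_ge0// sumr_ge0.
rewrite mxE (le_trans (ler_norm_sum _ _ _))//.
apply: (@le_trans _ _ ((\sum_j `|M i j|) * `|z|)).
  rewrite mulr_suml; apply: ler_sum => j _; rewrite normrM ler_wpM2l//.
  exact: ler_cV_norm.
by rewrite ler_wpM2r// [leRHS](bigD1 i)//= lerDl sumr_ge0.
Qed.

Lemma continuous_affine M v : continuous (fun x : 'cV[R]_d => M *m x + v).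
Proof.
move=> x.
apply: (iffRL (@cvgrPdist_le R 'cV[R]_d 'cV[R]_d _ (nbhs_filter x) _ _)).
move=> e e0.
set C := \sum_i \sum_j `|M i j|.
have C0 : 0 <= C by rewrite sumr_ge0// => i _; rewrite sumr_ge0.
have C1 : 0 < C + 1 by lra.
near=> y.
rewrite opprD addrACA subrr addr0 -mulmxBr (le_trans (ler_norm_mulmx _ _))//.
have xy : `|x - y| <= e / (C + 1).
  near: y; apply: (@cvgr_dist_le _ _ _ (nbhs x) _ id x cvg_id).
  by rewrite divr_gt0.
apply: (@le_trans _ _ ((C + 1) * `|x - y|)); first by rewrite ler_wpM2r// lerDl.
by rewrite mulrC -ler_pdivlMr.
Unshelve. all: by end_near. Qed.

Lemma measurable_preimage_affine M v (E : set (Rd R d)) : measurable E ->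
  measurable ((fun x : Rd R d => (M *m (x : 'cV[R]_d) + v : Rd R d)) @^-1` E).
Proof.
move=> mE; rewrite -[X in measurable X]setTI.
suff : measurable_fun [set: Rd R d]
    (fun x : Rd R d => (M *m (x : 'cV[R]_d) + v : Rd R d)) by apply.
apply: (@measurability _ _ (Rd R d) (Rd R d) setT _ (@open 'cV[R]_d)) => //.
move=> _ [U oU <-].
apply: sub_sigma_algebra; rewrite setTI.
by apply: open_comp => // x _; exact: continuous_affine.
Qed.

Lemma expansive_contracts (A : 'M[R]_d) : A \in unitmx -> expansive A ->
  forall rho delta : R, 0 < delta ->
  exists n, forall z, `|z| <= rho -> `|invmx A ^+ n *m z| < delta.
Proof.
move=> uA /(expansive_invmx_decay uA)[K [r [/andP[r0 r1] AK]]] rho delta d0.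
(* There are [d * d] entries, each at most [K * r ^+ n], acting on a vector of norm at most
   [rho]. *)
set C := (d%:R * d%:R * K * rho).
have : (fun n => C * r ^+ n) @ \oo --> C * 0.
  by apply: cvgMr; apply: cvg_expr; rewrite ger0_norm.
rewrite mulr0 => /cvgr_lt /(_ _ d0) [n _ /(_ n (leqnn n)) /= Cn].
exists n => z zrho; apply: le_lt_trans (ler_norm_mulmx _ _) _.
have S0 : 0 <= \sum_i \sum_j `|(invmx A ^+ n) i j|.
  by rewrite sumr_ge0// => i _; rewrite sumr_ge0.
apply: (le_lt_trans _ Cn); apply: (le_trans (ler_wpM2l S0 zrho)).
have rho0 : 0 <= rho by exact: le_trans (normr_ge0 z) zrho.
rewrite /C (_ : _ * r ^+ n = (d%:R * (d%:R * (K * r ^+ n))) * rho); last by ring.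
rewrite ler_wpM2r//.
have E (c : R) : \sum_(i < d) c = d%:R * c by rewrite sumr_const card_ord mulr_natl.
by rewrite -E ler_sum// => i _; rewrite -E ler_sum.
Qed.

End column_norm.

(** * Affine maps send Lebesgue null sets to null sets *)

Section lebesgue_null_sets.
Variables (R : realType) (d : nat).
Implicit Types (E F : set (Rd R d)) (a b v : 'cV[R]_d) (M : 'M[R]_d).

Lemma box_volume_ge0 a b : (forall i, a i 0 <= b i 0) -> 0 <= box_volume a b.
Proof. by move=> ab; apply: prodr_ge0 => i _; rewrite subr_ge0. Qed.

Lemma lebesgueRd_ge0 E : (0 <= lebesgueRd E)%E.
Proof.
apply: le_ereal_inf_tmp => _ [K [a [b [ab _ ->]]]].
by apply: esum_ge0 => k Kk; rewrite lee_fin box_volume_ge0//; exact: ab.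
Qed.

(** Index sets are carried into [nat] by [pickle], so that covers indexed by pairs can be used; the
    default 0 is never reached on the image of [K]. *)
Lemma lebesgueRd_le_cover (I : countType) (K : set I) (a b : I -> 'cV[R]_d) E :
  (forall k, K k -> forall i, a k i 0 <= b k i 0) ->
  E `<=` \bigcup_(k in K) box (a k) (b k) ->
  (lebesgueRd E <= \esum_(k in K) (box_volume (a k) (b k))%:E)%E.
Proof.
move=> ab EK; apply: ereal_inf_lbound.
exists (choice.pickle @` K), (fun n => oapp a 0 (choice.unpickle n)),
  (fun n => oapp b 0 (choice.unpickle n)); split.
- by move=> _ [k Kk <-] i; rewrite choice.pickleK/=; exact: ab.
- by move=> x /EK[k Kk xk]; exists (choice.pickle k);
    [exists k|rewrite choice.pickleK].
- rewrite (reindex_esum K _ choice.pickle); first by apply: eq_esum => k _; rewrite choice.pickleK.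
  split; [by move=> k Kk; exists k| |by []].
  by move=> k l _ _; apply: (pcan_inj (@choice.pickleK I)).
Qed.

Lemma esum_pZl (I : choiceType) (K : set I) (c : R) (u : I -> \bar R) :
  0 < c -> (forall k, K k -> 0 <= u k)%E ->
  (\esum_(k in K) (c%:E * u k) = c%:E * \esum_(k in K) u k)%E.
Proof.
move=> c0 u0; rewrite /esum -ereal_sup_pZl// image_comp; congr ereal_sup.
apply: eq_imagel => F [finF FK] /=.
rewrite !fsbig_finite//= big_seq [in RHS]big_seq ge0_sume_distrr// => k.
by rewrite in_fset_set// inE => /FK/u0.
Qed.

(* Cubes of side the smallest side [s] of the box: along a side of length [l]
   [l / s + 1 <= 2 l / s] of them suffice. *)
Lemma box_sub_bigcup_balls a b : (forall i, a i 0 <= b i 0) ->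
  exists s : seq ('cV[R]_d * R),
  [/\ forall q, q \in s -> 0 < q.2,
      forall x, box a b x -> exists2 q, q \in s & `|x - q.1| <= q.2 &
      \sum_(q <- s) q.2 ^+ d <= 2 ^+ d * box_volume a b].
Proof.
(* A box with a degenerate side is empty, because boxes are half-open. *)
move=> ab; have [[i abi]|/forallNP ltab] := pselect (exists i, b i 0 <= a i 0).
  exists [::]; split=> //; last first.
    by rewrite big_nil mulr_ge0 ?exprn_ge0// box_volume_ge0.
  move=> x /(_ i); rewrite in_itv /= => /andP[+ /le_trans /(_ abi)].
  by rewrite ltNge => /negP.
pose l i := b i 0 - a i 0.
have l0 i : 0 < l i by rewrite subr_gt0 ltNge; apply/negP/ltab.
(* The initial value 1 also caps [s], and is its value when [d = 0]; what matters is [0 < s] and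
   [s <= l i]. *)
pose s : R := \big[Num.min/1]_i l i.
have s0 : 0 < s by apply: lt_bigmin.
have sl i : s <= l i by exact: bigmin_le.
pose n i := (Num.truncn (l i / s)).+1.
pose N := (\max_i n i)%N.
have nN i : (n i <= N)%N by exact: leq_bigmax.
pose Q i := [pred j : 'I_N | (j < n i)%N].
(* Lower corner of the grid cube with index [f]; the sup norm ball of radius [s] about it contains
   that cube. *)
pose c (f : {ffun 'I_d -> 'I_N}) : 'cV[R]_d := \col_i (a i 0 + s * (f i)%:R).
exists [seq (c f, s) | f <- enum (family Q)]; split.
- by move=> q /mapP[f _ ->].
- move=> x xab.
  have xa i : 0 <= (x i 0 - a i 0) / s.
    have := xab i; rewrite in_itv /= => /andP[ax _].
    by apply: divr_ge0; [rewrite subr_ge0 ltW|exact: ltW].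
  have tn i : (Num.truncn ((x i 0 - a i 0) / s)%R < n i)%N.
    rewrite ltnS; apply: le_truncn; rewrite ler_pM2r ?invr_gt0// lerD2r.
    by have := xab i; rewrite in_itv /= => /andP[].
  pose f : {ffun 'I_d -> 'I_N} := [ffun i => Ordinal (leq_trans (tn i) (nN i))].
  exists (c f, s).
    by apply: map_f; rewrite mem_enum; apply/familyP => i; rewrite inE ffunE /= tn.
  apply: cV_norm_le => [|i]; first exact: ltW.
  rewrite !mxE ffunE /=.
  have /andP[t1 t2] := truncn_itv (xa i).
  rewrite ler_pdivlMr// in t1; rewrite ltr_pdivrMr// -natr1 in t2.
  by rewrite ler_norml; apply/andP; split; nra.
- rewrite big_map big_enum /=.
  have E : s ^+ d = \prod_(i < d) s by rewrite prodr_const card_ord.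
  rewrite (eq_bigr (fun f : {ffun 'I_d -> 'I_N} => \prod_(i < d) s)) => [|f _];
    last exact: E.
  rewrite -(bigA_distr_big_dep _ (fun i (j : 'I_N) => s)) /box_volume.
  rewrite (_ : 2 ^+ d = \prod_(i < d) 2); last by rewrite prodr_const card_ord.
  rewrite -big_split /=; apply: ler_prod => i _.
  rewrite -(big_ord_widen _ (fun=> s) (nN i)) sumr_const card_ord.
  rewrite -[s *+ n i]mulr_natl mulr_ge0 ?(ltW s0)//=.
  have ls0 : 0 <= l i / s by rewrite divr_ge0 ?ltW.
  have /andP[t1 _] := truncn_itv ls0.
  rewrite /n -natr1 mulrDl mul1r; rewrite ler_pdivlMr// in t1.
  by have := sl i; rewrite /l in t1 *; lra.
Qed.

(** The map is Lipschitz for the sup norm, so it sends each ball into a cube of comparable side.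
    Covering the boxes by balls first multiplies the total volume of a cover by at most the fixed
    factor [D]. *)
Lemma lebesgueRd_image_affine0 M v E F : lebesgueRd E = 0%E ->
  (forall x, F x -> exists2 y : 'cV[R]_d, E y & x = M *m y + v :> 'cV[R]_d) ->
  lebesgueRd F = 0%E.
Proof.
move=> E0 FE.
set C := \sum_i \sum_j `|M i j|.
have C0 : 0 <= C by rewrite sumr_ge0// => i _; rewrite sumr_ge0.
(* The strict inequality [C < w] places the images inside half-open boxes. *)
pose w := C + 1.
have w0 : 0 < w by rewrite /w; lra.
(* The factor [2 ^+ d] pays for replacing boxes by balls, and [(2 * w) ^+ d] for the cube of side
   [2 * w * r] around the image of a ball of radius [r]. *)
pose D := (2 * w) ^+ d * 2 ^+ d.
have D0 : 0 < D by rewrite mulr_gt0// exprn_gt0// mulr_gt0.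
apply/eqP; rewrite eq_le lebesgueRd_ge0 andbT; apply/lee_addgt0Pr => e e0.
rewrite add0e.
have [_ [K [a [b [ab EK ->]]]] Ke] : exists2 y,
    [set v | exists (K : set nat) (a b : nat -> 'cV[R]_d),
    [/\ forall k, K k -> forall i, a k i 0 <= b k i 0,
        E `<=` \bigcup_(k in K) box (a k) (b k) &
        v = \esum_(k in K) (box_volume (a k) (b k))%:E]] y & (y < (e / D)%:E)%E.
  by apply: ereal_inf_lt; rewrite [X in (X < _)%E]E0 lte_fin divr_gt0.
have /choice[s sP] k : exists s : seq ('cV[R]_d * R), K k ->
  [/\ forall q, q \in s -> 0 < q.2,
      forall x, box (a k) (b k) x -> exists2 q, q \in s & `|x - q.1| <= q.2 &
      \sum_(q <- s) q.2 ^+ d <= 2 ^+ d * box_volume (a k) (b k)].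
  have [Kk|nKk] := pselect (K k); last by exists [::].
  by have [s sP] := box_sub_bigcup_balls (ab k Kk); exists s.
pose q (k : nat * nat) := nth (0, 0) (s k.1) k.2.
pose J k := `I_(size (s k)).
pose a' k : 'cV[R]_d := \col_i ((M *m (q k).1 + v) i 0 - w * (q k).2).
pose b' k : 'cV[R]_d := \col_i ((M *m (q k).1 + v) i 0 + w * (q k).2).
have q0 k : (K `*`` J) k -> 0 < (q k).2.
  by move=> [Kk Jk]; have [+ _ _] := sP _ Kk; apply; exact: mem_nth.
have vol k : box_volume (a' k) (b' k) = (2 * w) ^+ d * (q k).2 ^+ d.
  rewrite -exprMn /box_volume (eq_bigr (fun=> 2 * w * (q k).2)).
    by rewrite prodr_const card_ord.
  by move=> i _; rewrite !mxE; ring.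
apply: (@le_trans _ _ (\esum_(k in K `*`` J) (box_volume (a' k) (b' k))%:E)).
  apply: lebesgueRd_le_cover => [k kKJ i|x /FE[y Ey ->]].
    by rewrite !mxE lerD2l; have := q0 k kKJ; have := w0; nra.
  have [k Kk yk] := EK _ Ey.
  have [_ /(_ _ yk)[c cs yc] _] := sP _ Kk.
  have qE : q (k, index c (s k)) = c by rewrite /q /= nth_index.
  exists (k, index c (s k)).
    by split => //=; rewrite /J /= index_mem.
  move=> i; rewrite in_itv /= [a' _ _ _]mxE [b' _ _ _]mxE qE.
  have c0 : 0 < c.2 by have [+ _ _] := sP _ Kk; apply.
  have : `|(M *m (y - c.1)) i 0| <= C * c.2.
    apply: (le_trans (ler_cV_norm _ _)); apply: (le_trans (ler_norm_mulmx _ _)).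
    by rewrite ler_wpM2l.
  rewrite mulmxBr ler_norml [X in _ <= X <= _]mxE [(- _ : 'cV[R]_d) _ _]mxE.
  rewrite ![(_ + v) _ _]mxE /w => /andP[m1 m2].
  by apply/andP; split; lra.
rewrite -(esum_esum (a := fun i j => (box_volume (a' (i, j)) (b' (i, j)))%:E));
  last first.
  move=> i j Ki Jj; rewrite lee_fin vol mulr_ge0 ?exprn_ge0 ?mulr_ge0 ?ltW//.
  exact: q0.

apply: (@le_trans _ _ (\esum_(k in K) (D%:E * (box_volume (a k) (b k))%:E)%E)).
  apply: le_esum => k Kk; rewrite esum_fset; [|exact: finite_II|]; last first.
    move=> j; rewrite inE => Jj.
    rewrite lee_fin vol mulr_ge0 ?exprn_ge0 ?mulr_ge0 ?ltW//; exact: q0.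
  rewrite /J -fsbig_ord sumEFin -EFinM lee_fin /D -mulrA.
  have [_ _ sk] := sP _ Kk.
  apply: le_trans (ler_wpM2l _ sk); last by rewrite exprn_ge0// mulr_ge0// ltW.
  rewrite (big_nth (0, 0)) big_mkord mulr_sumr.
  by apply: ler_sum => j _; rewrite vol.
rewrite esum_pZl//; last first.
  by move=> k Kk; rewrite lee_fin box_volume_ge0//; exact: ab.
have := lee_wpmul2l (ltW (D0 : (0 < D%:E)%E)) (ltW Ke).
by rewrite -EFinM mulrC divfK ?gt_eqF.
Qed.

End lebesgue_null_sets.

(** * Removal of null sets and values of finite measures *)

Section measure_facts.
Context d (T : measurableType d) (R : realType).
Implicit Types (m : {measure set T -> \bar R}) (E N : set T).

Lemma measureD0 m E N :
  measurable E -> measurable N -> m N = 0%E -> m (E `\` N) = m E.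
Proof.
move=> mE mN N0.
rewrite (measureDI m mE mN) [X in _ = (_ + X)%E](_ : _ = 0%E) ?adde0//.
by apply: (subset_measure0 _ mN) => //; exact: measurableI.
Qed.

Lemma measure_bounded_fin m (c : R) E : m setT = c%:E -> measurable E ->
  exists2 r, m E = r%:E & 0 <= r <= c.
Proof.
move=> mT mE.
have mc : (m E <= c%:E)%E by rewrite -mT; apply: le_measure; rewrite ?inE.
have fE : m E \is a fin_num by rewrite ge0_fin_numE// (le_lt_trans mc)// ltry.
by exists (fine (m E)); rewrite ?fineK// -!lee_fin fineK// measure_ge0.
Qed.

End measure_facts.

(** * Invariance of the absolutely continuous part, and iteration of the invariance equation *)

Section invariance.
Variables (R : realType) (d : nat) (A : 'M[R]_d).
Hypothesis uA : A \in unitmx.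
Implicit Types (E F N : set (Rd R d)) (b v : 'cV[R]_d).

Let tauK b (x : Rd R d) : A *m (tau A b x : 'cV[R]_d) - b = x :> 'cV[R]_d.
Proof. by rewrite /tau mulmxA mulmxV// mul1mx addrK. Qed.

Let tauVK b (y : Rd R d) : tau A b (A *m (y : 'cV[R]_d) - b) = y.
Proof. by rewrite /tau subrK mulmxA mulVmx// mul1mx. Qed.

Lemma measurable_tau b E : measurable E -> measurable (tau A b @^-1` E).
Proof.
move=> mE; rewrite (_ : tau A b =
  (fun x : Rd R d => invmx A *m (x : 'cV[R]_d) + invmx A *m b : Rd R d)).
  exact: measurable_preimage_affine.
by apply/funext => x; rewrite /tau mulmxDr.
Qed.

Lemma lebesgueRd_tau0 b E : lebesgueRd E = 0%E ->
  lebesgueRd (tau A b @^-1` E) = 0%E.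
Proof.
move=> E0; apply: (lebesgueRd_image_affine0 (M := A) (v := - b) E0) => x Ex.
by exists (tau A b x) => //; rewrite tauK.
Qed.

(** The image of [N] under [tau A b], written as a preimage under the inverse map so that it is
    visibly measurable. *)
Let image_tau b N := (fun y : Rd R d => A *m (y : 'cV[R]_d) - b : Rd R d) @^-1` N.

Let lebesgueRd_image_tau0 b N : lebesgueRd N = 0%E ->
  lebesgueRd (image_tau b N) = 0%E.
Proof.
move=> N0.
apply: (lebesgueRd_image_affine0 (M := invmx A) (v := invmx A *m b) N0) => y Ny.
exists (A *m (y : 'cV[R]_d) - b) => //.
by rewrite -mulmxDr -[RHS]/(tau A b (A *m (y : 'cV[R]_d) - b)) tauVK.
Qed.

(** Domination asks that every measurable subset of [E] be null for [lebesgueRd]; this follows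
    because a cover of [E] also covers its subsets. *)
Lemma abs_cont_lebesgueRd0 (m : {measure set (Rd R d) -> \bar R}) E :
  m `<< @lebesgueRd R d -> measurable E -> lebesgueRd E = 0%E -> m E = 0%E.
Proof.
move=> mac mE E0; apply: (mac E) => // F mF FE.
apply/eqP; rewrite eq_le lebesgueRd_ge0 andbT -E0.
apply: le_ereal_inf => _ [K [a [c [ab EK ->]]]].
by exists K, a, c; split => //; exact: subset_trans EK.
Qed.

Variables (B : {fset 'cV[R]_d}) (p : 'cV[R]_d -> R).

(* A null set carrying the singular part, enlarged by its images under the
   [tau A b], separates the two parts of [mu] on both sides of the equation. *)
Lemma hutchinson_abs_cont (mu m_ac m_s : {measure set (Rd R d) -> \bar R}) :
  hutchinson_measure A B p mu ->
  (forall E, measurable E -> mu E = (m_ac E + m_s E)%E) ->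
  m_ac `<< @lebesgueRd R d -> singular m_s -> hutchinson_measure A B p m_ac.
Proof.
move=> muH muE mac [N [mN N0 sN]].
pose W := N `|` \big[setU/set0]_(b <- B) image_tau b N.
have [mW Wac Wtau] : [/\ measurable W, m_ac W = 0%E &
    forall b, m_ac (tau A b @^-1` W) = 0%E].
  pose P X := [/\ measurable X, m_ac X = 0%E &
    forall b, m_ac (tau A b @^-1` X) = 0%E].
  have null X : measurable X -> lebesgueRd X = 0%E -> P X.
    move=> mX X0; split=> [//||b]; apply: abs_cont_lebesgueRd0 => //.
      exact: measurable_tau.
    exact: lebesgueRd_tau0.
  have PU X Y : P X -> P Y -> P (X `|` Y).
    move=> [mX X0 Xt] [mY Y0 Yt]; split=> [||b]; first exact: measurableU.
      by rewrite measureU0.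
    by rewrite preimage_setU measureU0//; exact: measurable_tau.
  apply: (PU); first exact: null.
  apply: big_ind => [|X Y PX PY|b _]; [|exact: PU|].
    by split=> [||b]; rewrite ?preimage_set0 ?measure0//; exact: measurable0.
  by apply: null; [exact: measurable_preimage_affine|exact: lebesgueRd_image_tau0].
have m_s0 X : measurable X -> X `<=` ~` N -> m_s X = 0%E.
  by move=> mX XN; apply: (subset_measure0 mX (measurableC mN)).
move=> E mE.
have mEW : measurable (E `\` W) by exact: measurableD.
rewrite -(measureD0 mE mW Wac).
have -> : m_ac (E `\` W) = mu (E `\` W).
  by rewrite muE// (m_s0 (E `\` W)) ?adde0// => x [_ Wx] Nx; apply: Wx; left.
rewrite muH// big_seq [RHS]big_seq; apply: eq_bigr => b bB.
rewrite /pushforward; congr (_ * _)%E.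
have mb := measurable_tau b mEW.
(* A point of [N] is sent by [tau A b] into [image_tau b N], hence into [W]; so the preimage of [E]
   minus [W] misses [N]. *)
rewrite muE// m_s0// ?adde0; last first.
  move=> x [_ Wx] Nx; apply: Wx; right; rewrite -bigcup_seq; exists b => //.
  by rewrite /image_tau /= tauK.
exact: (measureD0 (measurable_tau b mE) (measurable_tau b mW) (Wtau b)).
Qed.

Hypothesis p_ge0 : forall b, b \in B -> 0 <= p b.
Hypothesis p_sum1 : \sum_(b <- B) p b = 1.

(** The list runs over the words of length [n] in [B], with product weights. It is chosen before
    [nu], so two invariant measures can be compared map by map. *)
Lemma hutchinson_iter n : exists s : seq (R * 'cV[R]_d),
  [/\ forall q, q \in s -> 0 <= q.1, \sum_(q <- s) q.1 = 1 &
    forall nu : {measure set (Rd R d) -> \bar R}, hutchinson_measure A B p nu ->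
    forall E, measurable E -> nu E = (\sum_(q <- s) q.1%:E *
      nu ((fun x : Rd R d =>
        (invmx A ^+ n *m (x : 'cV[R]_d) + q.2)%R : Rd R d) @^-1` E))%E].
Proof.
elim: n => [|n [s [s0 s1 sE]]].
  exists [:: (1, 0)]; split=> [q|//|nu nuH E mE].
  - by rewrite inE => /eqP->.
  - by rewrite big_seq1.
  - rewrite big_seq1 mul1e; congr (nu _).
    by apply/seteqP; split => x /=; rewrite expr0 mul1mx addr0.
exists [seq (q.1 * p b, invmx A ^+ n *m (invmx A *m b) + q.2) | q <- s, b <- B].
split=> [q /allpairsP[[q' b] /= [q's bB ->]]||nu nuH E mE].
- by rewrite /= mulr_ge0 ?s0 ?p_ge0.
- rewrite big_allpairs_dep /= -[RHS]s1; apply: eq_bigr => q _.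
  by rewrite -mulr_sumr p_sum1 mulr1.
- rewrite big_allpairs_dep sE// big_seq [RHS]big_seq; apply: eq_bigr => q qs.
  rewrite nuH; last exact: measurable_preimage_affine.
  rewrite big_seq ge0_sume_distrr => [|b bB]; last first.
    by apply: mule_ge0; [rewrite lee_fin p_ge0|exact: (measure_ge0 nu)].
  rewrite [RHS]big_seq; apply: eq_bigr => b bB.
  rewrite muleA -EFinM /pushforward; congr (_ * nu _)%E.
  apply/seteqP; split => x /=; rewrite /tau exprSr mulmxDr mulmxDr -mulmxA addrA//.
Qed.

End invariance.

(** * Proportionality of finite invariant measures *)

Section uniqueness.
Variables (R : realType) (d : nat).
Implicit Types (E U : set (Rd R d)) (m : {measure set (Rd R d) -> \bar R}).

Let cV_ballE (x : 'cV[R]_d) (e : R) : ball x e = [set y | `|x - y| < e].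
Proof. by rewrite mx_norm_ball. Qed.

Definition norm_ball (rho : R) : set (Rd R d) := [set x | `|x : 'cV[R]_d| < rho].

Lemma measurable_norm_ball rho : measurable (norm_ball rho).
Proof.
apply: sub_sigma_algebra; rewrite /norm_ball /=.
have -> : [set x : 'cV[R]_d | `|x| < rho] = ball (0 : 'cV[R]_d) rho.
  by rewrite cV_ballE; apply/seteqP; split => x /=; rewrite sub0r normrN.
exact: ball_open.
Qed.

(** Continuity from above along the complements of balls, which decrease to the empty set. The bound
    covers all larger radii so that one radius can serve two measures. *)
Lemma tight_norm m (e : R) : (m setT < +oo)%E -> 0 < e ->
  exists rho, forall rho', rho <= rho' -> (m (~` norm_ball rho') <= e%:E)%E.
Proof.
move=> moo e0.
have mball rho : measurable (~` norm_ball rho).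
  by apply: measurableC; exact: measurable_norm_ball.
pose F n := ~` norm_ball n%:R.
have F0 : \bigcap_n F n = set0.
  apply/seteqP; split => // x /= Fx.
  have := Fx (Num.truncn `|x : 'cV[R]_d|).+1 I.
  by apply; rewrite /norm_ball /= truncnS_gt.
have Foo : (m (F 0%N) < +oo)%E.
  by apply: le_lt_trans moo; apply: le_measure; rewrite ?inE//; exact: mball.
have : (m \o F) x @[x --> \oo] --> m (\bigcap_n F n).
  apply: nonincreasing_cvg_mu => //.
  - by move=> n; exact: mball.
  - by rewrite F0.
  - move=> i j ij; apply/subsetPset => x /= Fx xi; apply: Fx.
    by apply: lt_le_trans xi _; rewrite ler_nat.
rewrite F0 measure0 => cv.
have [n _ /(_ n (leqnn n)) /= Fn] := cv _ (nbhs_open_ereal_lt (f := fun=> e) e0).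
exists n%:R => r nr; apply: le_trans (ltW Fn).
apply: le_measure; rewrite ?inE; [exact: mball|exact: mball|].
by move=> x /= xr xn; apply: xr; exact: lt_le_trans xn nr.
Qed.

Definition erosion U (delta : R) : set (Rd R d) :=
  [set x | forall y : 'cV[R]_d, `|y - x| < delta -> U y].

(** The complement is a union of open balls about the points outside [U], so the erosion is closed
    for an arbitrary [U]. *)
Lemma measurable_erosion U delta : measurable (erosion U delta).
Proof.
rewrite -[erosion U delta]setCK; apply: measurableC; apply: sub_sigma_algebra.
have -> : ~` erosion U delta = \bigcup_(y in ~` U) ball (y : 'cV[R]_d) delta.
  apply/seteqP; split => x.
    by move=> /existsNP[y /not_implyP[yx Uy]]; exists y => //; rewrite cV_ballE.
  by move=> [y Uy]; rewrite cV_ballE => yx Ux; exact/Uy/Ux.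
by apply: bigcup_open => y _; exact: ball_open.
Qed.

Variables (A : 'M[R]_d) (B : {fset 'cV[R]_d}) (p : 'cV[R]_d -> R).
Hypotheses (uA : A \in unitmx) (eA : expansive A).
Hypothesis p_ge0 : forall b, b \in B -> 0 <= p b.
Hypothesis p_sum1 : \sum_(b <- B) p b = 1.

(* Composing many maps shrinks a ball carrying almost all the mass of both
   measures to diameter less than [delta]: its image then either misses the
   erosion of [U] or lies in [U]. *)
Lemma hutchinson_erosion_le m1 m2 (c1 c2 : R) U (delta : R) :
  hutchinson_measure A B p m1 -> hutchinson_measure A B p m2 ->
  m1 setT = c1%:E -> m2 setT = c2%:E -> c1 <= 1 -> c2 <= 1 ->
  measurable U -> 0 < delta ->
  (c2%:E * m1 (erosion U delta) <= c1%:E * m2 U)%E.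
Proof.
move=> H1 H2 m1T m2T c1le c2le mU d0.
have c10 : 0 <= c1 by rewrite -lee_fin -m1T.
have c20 : 0 <= c2 by rewrite -lee_fin -m2T.
pose r1 E := fine (m1 E); pose r2 E := fine (m2 E).
have r1E E : measurable E -> m1 E = (r1 E)%:E /\ 0 <= r1 E <= c1.
  by move=> /(measure_bounded_fin m1T)[r mr rc]; rewrite /r1 mr.
have r2E E : measurable E -> m2 E = (r2 E)%:E /\ 0 <= r2 E <= c2.
  by move=> /(measure_bounded_fin m2T)[r mr rc]; rewrite /r2 mr.
have mV := measurable_erosion U delta.
rewrite (r1E _ mV).1 (r2E _ mU).1 -!EFinM lee_fin.
apply/ler_addgt0Pr => e e0.
have m1oo : (m1 setT < +oo)%E by rewrite m1T ltry.
have m2oo : (m2 setT < +oo)%E by rewrite m2T ltry.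
have [rho1 tight1] := tight_norm m1oo e0.
have [rho2 tight2] := tight_norm m2oo e0.
pose rho := Num.max rho1 rho2; pose K := norm_ball rho.
have mK : measurable K := measurable_norm_ball rho.
have mKC : measurable (~` K) := measurableC mK.
have K1 : r1 (~` K) <= e.
  by rewrite -lee_fin -(r1E _ mKC).1 tight1// le_max lexx.
have K2 : c2 - e <= r2 K.
  have : r2 (~` K) <= e.
    by rewrite -lee_fin -(r2E _ mKC).1 tight2// le_max lexx orbT.
  have : m2 setT = (m2 K + m2 (~` K))%E by rewrite -measureU ?setUv// setICr.
  rewrite m2T (r2E _ mK).1 (r2E _ mKC).1 -EFinD => -[->]; lra.
(* Two points of [K] differ by a vector of norm at most [rho + rho]. *)
have [n An] := expansive_contracts uA eA (rho + rho) d0.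
have [s [s0 s1 sE]] := hutchinson_iter A p_ge0 p_sum1 n.
pose f (q : R * 'cV[R]_d) (x : Rd R d) : Rd R d :=
  invmx A ^+ n *m (x : 'cV[R]_d) + q.2.
have mf q E : measurable E -> measurable (f q @^-1` E).
  exact: measurable_preimage_affine.
have sr1 E : measurable E -> r1 E = \sum_(q <- s) q.1 * r1 (f q @^-1` E).
  move=> mE; apply: EFin_inj; rewrite -(r1E _ mE).1 (sE _ H1 _ mE) -sumEFin.
  by apply: eq_bigr => q _; rewrite EFinM -(r1E _ (mf q _ mE)).1.
have sr2 E : measurable E -> r2 E = \sum_(q <- s) q.1 * r2 (f q @^-1` E).
  move=> mE; apply: EFin_inj; rewrite -(r2E _ mE).1 (sE _ H2 _ mE) -sumEFin.
  by apply: eq_bigr => q _; rewrite EFinM -(r2E _ (mf q _ mE)).1.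
have le1 E F : measurable E -> measurable F -> E `<=` F -> r1 E <= r1 F.
  move=> mE mF EF; rewrite -lee_fin -(r1E _ mE).1 -(r1E _ mF).1.
  by apply: le_measure; rewrite ?inE.
have le2 E F : measurable E -> measurable F -> E `<=` F -> r2 E <= r2 F.
  move=> mE mF EF; rewrite -lee_fin -(r2E _ mE).1 -(r2E _ mF).1.
  by apply: le_measure; rewrite ?inE.
(* If some point of [K] lands in the erosion, all of [K] lands in [U], so the [r2] term is at least
   [c2 - e]; otherwise the [r1] term is at most [e]. As [c1] and [c2] are at most 1, the error stays
   below [e]. *)
have key q : c2 * r1 (f q @^-1` erosion U delta) <= c1 * r2 (f q @^-1` U) + e.
  have [_ /andP[r20 r2c]] := r2E _ (mf q _ mU).
  have [_ /andP[r10 r1c]] := r1E _ (mf q _ mV).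
  have [[x [Kx Vx]]|/forallNP KV] :=
    pselect (exists x, K x /\ erosion U delta (f q x)).
    have KU : K `<=` f q @^-1` U.
      move=> y Ky; apply: Vx; rewrite /f opprD addrACA subrr addr0 -mulmxBr.
      apply: An; apply: (le_trans (ler_normB _ _)).
      by apply: lerD; apply: ltW; [exact: Ky|exact: Kx].
    have := le2 _ _ mK (mf q _ mU) KU; nra.
  have VK : f q @^-1` erosion U delta `<=` ~` K by move=> x Vx Kx; apply: (KV x).
  have := le1 _ _ (mf q _ mV) mKC VK; nra.
rewrite (sr1 _ mV) (sr2 _ mU) !mulr_sumr -[e]mul1r -s1 mulr_suml -big_split /=.
rewrite big_seq [leRHS]big_seq; apply: ler_sum => q qs.
have := key q; have := s0 q qs; nra.
Qed.

(** For open [U] the erosions by [1 / (n + 1)] increase to [U], and continuity from below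
    applies. *)
Lemma hutchinson_open_le m1 m2 (c1 c2 : R) U :
  hutchinson_measure A B p m1 -> hutchinson_measure A B p m2 ->
  m1 setT = c1%:E -> m2 setT = c2%:E -> c1 <= 1 -> c2 <= 1 ->
  @open 'cV[R]_d U -> (c2%:E * m1 U <= c1%:E * m2 U)%E.
Proof.
move=> H1 H2 m1T m2T c1le c2le oU.
have mU : measurable U by exact: sub_sigma_algebra.
pose V n := erosion U n.+1%:R^-1.
have VU : \bigcup_n V n = U.
  apply/seteqP; split => x.
    by move=> [n _ Vx]; apply: Vx; rewrite subrr normr0 invr_gt0.
  move=> Ux; have [e /= e0 eU] := (nbhs_ballP _ _).1 (open_nbhs_nbhs (conj oU Ux)).
  exists (Num.truncn e^-1) => // y yx; apply: eU; rewrite cV_ballE /= distrC.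
  apply: (lt_trans yx); rewrite invf_plt ?posrE//; exact: truncnS_gt.
have mV n : measurable (V n) by exact: measurable_erosion.
have cv : (m1 \o V) x @[x --> \oo] --> m1 (\bigcup_n V n).
  apply: nondecreasing_cvg_mu => //; first by rewrite VU.
  move=> i j ij; apply/subsetPset => x /= Vx y yx; apply: Vx.
  by apply: (lt_le_trans yx); rewrite lef_pV2 ?posrE// ler_nat.
rewrite -{1}VU.
apply: (cvge_le _ (cvgeZl (y := c2%:E) isT cv)).
by near=> n; apply: hutchinson_erosion_le; rewrite ?invr_gt0.
Unshelve. all: by end_near. Qed.

(** Exchanging the two measures turns the inequality into equality on open sets, a generating family
    closed under intersection; finite measures agreeing there agree on all Borel sets. *)
Lemma hutchinson_proportional m1 m2 (c1 c2 : R) :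
  hutchinson_measure A B p m1 -> hutchinson_measure A B p m2 ->
  m1 setT = c1%:E -> m2 setT = c2%:E -> c1 <= 1 -> c2 <= 1 ->
  forall E, measurable E -> (c2%:E * m1 E = c1%:E * m2 E)%E.
Proof.
move=> H1 H2 m1T m2T c1le c2le E mE.
have c10 : 0 <= c1 by rewrite -lee_fin -m1T.
have c20 : 0 <= c2 by rewrite -lee_fin -m2T.
apply: (@measure_unique _ R (Rd R d) (@open 'cV[R]_d) (fun=> setT) erefl _ _ _
  (mscale (NngNum c20) m1) (mscale (NngNum c10) m2)) => //.
- exact: openI.
- by move=> n; exact: openT.
- exact: bigcup_const.
- move=> U oU; apply/eqP; rewrite eq_le /mscale/=.
  by rewrite !hutchinson_open_le.
- by move=> n; rewrite -[X in (X < _)%E]/(c2%:E * m1 setT)%E m1T -EFinM ltry.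
Qed.

End uniqueness.

(** * The dichotomy, from proportionality of [mu] and [mu_ac] *)

Theorem theorem3p10 (R : realType) (d : nat) (A : 'M[R]_d)
  (invA : A \in unitmx) (expA : expansive A)
  (B : {fset 'cV[R]_d}) (p : 'cV[R]_d -> R)
  (p_gt0 : forall b, b \in B -> 0 < p b)
  (p_sum1 : \sum_(b <- B) p b = 1)
  (mu : probability (Rd R d) R) (muH : hutchinson_measure A B p mu)
  (mu_ac mu_pp mu_cs : {measure set (Rd R d) -> \bar R})
  (mu_dec : canonical_decomposition mu mu_ac mu_pp mu_cs)
  (mu_eq : forall E, measurable E -> mu E = (mu_ac E + mu_cs E)%E) :
  (forall E, measurable E -> mu_ac E = 0%E) \/
  (forall E, measurable E -> mu_cs E = 0%E).
Proof.
have [_ ac _ _ [N [mN N0 csN]]] := mu_dec.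
have acH : hutchinson_measure A B p mu_ac.
  by apply: (hutchinson_abs_cont invA muH mu_eq ac); exists N.
have p_ge0 b : b \in B -> 0 <= p b by move=> /p_gt0/ltW.
have muT : mu setT = 1%:E by exact: probability_setT.
have acT : (mu_ac setT <= 1)%E by rewrite -muT mu_eq// leeDl.
have [c acTE /andP[_ c1]] : exists2 c, mu_ac setT = c%:E & 0 <= c <= 1.
  exists (fine (mu_ac setT)).
    by rewrite fineK// ge0_fin_numE// (le_lt_trans acT)// ltry.
  rewrite fine_ge0//= -[leRHS]/(fine 1%:E) fine_le//.
  by rewrite ge0_fin_numE// (le_lt_trans acT)// ltry.
have := hutchinson_proportional invA expA p_ge0 p_sum1 muH acH muT acTE
  (lexx 1) c1 mN.
rewrite mul1e (abs_cont_lebesgueRd0 ac mN N0) => /eqP.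
rewrite mule_eq0 => /orP[/eqP c0|/eqP muN]; [left|right] => E mE.
  by apply: (subset_measure0 mE measurableT) => //; exact: etrans acTE c0.
(* On [N] the singular part is dominated by [mu], and off [N] it vanishes by singularity. *)
have csN0 : mu_cs N = 0%E.
  apply/eqP; rewrite eq_le measure_ge0 andbT.
  by rewrite -[leRHS](muN : mu N = 0%E) mu_eq// leeDr.
apply: (subset_measure0 mE measurableT) => //.
have : mu_cs setT = (mu_cs N + mu_cs (~` N))%E.
  by rewrite -measureU ?setUv// ?setICr//; exact: measurableC.
by rewrite csN0 csN adde0.
Qed.
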